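(* Let $U$ and $V$ be real normed spaces. Then $\mathcal{B}(U,V) \subseteq \mathcal{B}_{st}(U,V) = \mathcal{B}_{st}^{n}(U,V)$.
   Context: The natural density of $K\subseteq\mathbb{N}$ is $\delta(K)=\lim_{n\to\infty}\frac1n|\{k\le n: k\in K\}|$ when the limit exists. A sequence $(x_n)$ in a normed space $U$ is statistically bounded if there is $M>0$ with $\delta(\{n\in\mathbb{N}:\|x_n\|>M\})=0$. $\ell_\infty(U)$ denotes the set of norm-bounded sequences in $U$ and $\ell_\infty^{st}(U)$ the set of statistically bounded sequences in $U$. An operator $S:U\to V$ here is an arbitrary function (not necessarily linear); for a sequence $x=(x_n)$ in $U$, $S$ acts termwise, $S(x)=(S(x_n))$. $\mathcal{B}(U,V)$ is the set of norm-bounded operators, i.e. operators mapping norm-bounded sets to norm-bounded sets. $\mathcal{B}_{st}^{n}(U,V)$ is the set of norm-statistically bounded ($n$-$st$-bounded) operators, i.e. those with $S(\ell_\infty(U))\subseteq\ell_\infty^{st}(V)$. $\mathcal{B}_{st}(U,V)$ is the set of statistically bounded ($st$-bounded) operators, i.e. those with $S(\ell_\infty^{st}(U))\subseteq\ell_\infty^{st}(V)$. *)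

(* Defs.v *)
From mathcomp Require Import all_boot all_order all_algebra.
From mathcomp Require Import all_classical all_reals all_analysis.
Import numFieldNormedType.Exports.

Set Implicit Arguments.
Unset Strict Implicit.
Unset Printing Implicit Defensive.

Import Order.TTheory GRing.Theory Num.Theory.

Local Open Scope classical_set_scope.
Local Open Scope ring_scope.

(* [has_natural_density R K d] means that the limit defining delta(K) exists and
   equals d. Indices start at 0, so {k <= n : k \in K} is a subset of 'I_n.+1;
   the n = 0 quotient is the junk value 0 and does not affect the limit. *)
Definition has_natural_density (R : realType) (K : set nat) (d : R) : Prop :=
  (fun n : nat => #|[pred k : 'I_n.+1 | `[< K k >]]|%:R / n%:R : R)
    @ \oo --> d.

Definition st_bounded_seq (R : realType) (U : normedModType R)
    (x : nat -> U) : Prop :=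
  exists2 M : R, 0 < M & has_natural_density [set n | M < `|x n|] (0 : R).

Definition linfty (R : realType) (U : normedModType R) : set (nat -> U) :=
  [set x | bounded_fun x].
Arguments linfty {R} U.

Definition linfty_st (R : realType) (U : normedModType R) : set (nat -> U) :=
  [set x | st_bounded_seq x].
Arguments linfty_st {R} U.

(* Operators are arbitrary functions U -> V, and S acts termwise on sequences,
   so S(x) is S \o x. *)

Definition norm_bounded_ops (R : realType) (U V : normedModType R) :
    set (U -> V) :=
  [set S : U -> V | forall A : set U, bounded_set A -> bounded_set (S @` A)].
Arguments norm_bounded_ops {R} U V.

Definition norm_st_bounded_ops (R : realType) (U V : normedModType R) :
    set (U -> V) :=
  [set S : U -> V | [set S \o x | x in linfty U] `<=` linfty_st V].
Arguments norm_st_bounded_ops {R} U V.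

Definition st_bounded_ops (R : realType) (U V : normedModType R) :
    set (U -> V) :=
  [set S : U -> V | [set S \o x | x in linfty_st U] `<=` linfty_st V].
Arguments st_bounded_ops {R} U V.

(* Main.v *)
Require Import Defs.
From mathcomp Require Import all_boot all_order all_algebra.
From mathcomp Require Import all_classical all_reals all_analysis.
Import numFieldNormedType.Exports.

(** A statistically bounded sequence x agrees, outside a set of density 0, with
    the bounded sequence obtained by replacing its large terms by 0. Applying S
    preserves this agreement, and a sequence that agrees off a set of density 0
    with a statistically bounded one is itself statistically bounded. *)

Import Order.TTheory GRing.Theory Num.Theory.

Local Open Scope classical_set_scope.
Local Open Scope ring_scope.

Lemma has_natural_density_set0 (R : realType) :
  has_natural_density (set0 : set nat) (0 : R).
Proof.
rewrite /has_natural_density.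
under eq_fun => n.
  rewrite eq_card0 ?mul0r; last by move=> k; rewrite inE; apply/asboolP.
  over.
exact: cvg_cst.
Qed.

(** The counting quotient of [C] is squeezed between 0 and the sum of the quotients of [A] and [B],
    which tends to 0. *)
Lemma has_natural_density0_subU (R : realType) (A B C : set nat) :
  C `<=` A `|` B -> has_natural_density A (0 : R) ->
  has_natural_density B (0 : R) -> has_natural_density C (0 : R).
Proof.
move=> CAB dA dB.
rewrite /has_natural_density.
have dAB := cvgD dA dB; rewrite addr0 in dAB.
apply: squeeze_cvgr (cvg_cst 0) (dAB _); apply: nearW => n; rewrite divr_ge0 //=.
(* By inclusion-exclusion the two counts add up to union plus intersection; the intersection term is
   then dropped. *)
rewrite fctE -mulrDl ler_wpM2r ?invr_ge0 // -natrD ler_nat -cardUI.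
apply: leq_trans (leq_addr _ _).
apply: subset_leq_card; apply/fintype.subsetP => k.
rewrite !inE => Ck; apply/orP.
by case: (CAB _ Ck) => /asboolP; [left | right].
Qed.

Lemma linfty_sub_st (R : realType) (U : normedModType R) :
  linfty U `<=` linfty_st U.
Proof.
move=> x /pinfty_ex_gt0[M M0 xM]; exists M => //.
(* Since [M] bounds every term, the exceptional set is empty. *)
apply: has_natural_density0_subU (has_natural_density_set0 R)
  (has_natural_density_set0 R) => n /= ltMx.
by have := xM n I; rewrite /= leNgt ltMx.
Qed.

(** The range of a bounded sequence is a bounded set, so its image under [S] bounds all terms of
    [S \o x]. *)
Lemma norm_bounded_ops_sub_n_st (R : realType) (U V : normedModType R) :
  norm_bounded_ops U V `<=` norm_st_bounded_ops U V.
Proof.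
move=> S bS _ [x bx <-]; apply: linfty_sub_st.
have [N [Nreal SN]] : bounded_set (S @` range x).
  apply: bS; case: bx => M [Mreal xM]; exists M; split=> // N /xM xN.
  by move=> _ [n _ <-]; exact: xN.
by exists N; split=> // M /SN SM n _; apply: SM; exists (x n) => //; exists n.
Qed.

Lemma n_st_bounded_ops_sub_st (R : realType) (U V : normedModType R) :
  norm_st_bounded_ops U V `<=` st_bounded_ops U V.
Proof.
move=> S bS _ [x [M M0 dx] <-].
pose y n := if `|x n| <= M then x n else 0.
have by_ : linfty U y.
  exists M; split; first exact: num_real.
  move=> N MN n _; rewrite /y /=; case: ifPn => [xM|_].
    exact: le_trans xM (ltW MN).
  by rewrite normr0 (ltW (lt_trans M0 MN)).
have [|N N0 dy] := bS (S \o y); first by exists y.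
(* An index with [N < |S (x n)|] either has [M < |x n|], whatever [S 0] is, or satisfies [y n = x n]
   and is exceptional for [S \o y]. *)
exists N => //; apply: has_natural_density0_subU dx dy => n /= SxN.
by have [xM|] := leP `|x n| M; [right; rewrite /y xM | left].
Qed.

Theorem lemma2p4 (R : realType) (U V : normedModType R) :
  norm_bounded_ops U V `<=` st_bounded_ops U V /\
  st_bounded_ops U V = norm_st_bounded_ops U V.
Proof.
split.
  exact: subset_trans (@norm_bounded_ops_sub_n_st R U V)
    (@n_st_bounded_ops_sub_st R U V).
apply/seteqP; split; last exact: n_st_bounded_ops_sub_st.
(* Bounded sequences are among the statistically bounded ones on which [S] is already controlled. *)
by move=> S bS _ [x bx <-]; apply: bS; exists x => //; exact: linfty_sub_st.
Qed.
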